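(* For every integer $n\ge 1$, the ball algebra $A(\mathbf B_n)$ is not a coherent ring.
   Context: $\mathbf B_n=\{(z_1,\dots,z_n)\in\mathbb C^n:\sum_{j=1}^n|z_j|^2\le 1\}$ is the closed unit ball of $\mathbb C^n$. The ball algebra $A(\mathbf B_n)$ is the algebra (with pointwise operations and supremum norm) of all continuous functions $f:\mathbf B_n\to\mathbb C$ that are holomorphic in the interior of $\mathbf B_n$. A commutative unital ring is called coherent if the intersection of any two finitely generated ideals is finitely generated. *)

(* Defs.v *)
From HB Require Import structures.
From mathcomp Require Import all_boot all_order all_algebra.
From mathcomp Require Import all_classical all_reals all_analysis.
From mathcomp Require Import complex.

Set Implicit Arguments.
Unset Strict Implicit.
Unset Printing Implicit Defensive.

Import Order.TTheory GRing.Theory Num.Theory.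
Import numFieldNormedType.Exports.

Local Open Scope classical_set_scope.
Local Open Scope ring_scope.
Local Open Scope complex_scope.

Section Coherence.
Variable A : comPzRingType.

Definition ideal_of (n : nat) (a : 'I_n -> A) : set A :=
  [set x | exists c : 'I_n -> A, x = \sum_i c i * a i].

Definition fg_ideal (I : set A) : Prop :=
  exists (n : nat) (a : 'I_n -> A), I = ideal_of a.

Definition coherent : Prop :=
  forall I J : set A, fg_ideal I -> fg_ideal J -> fg_ideal (I `&` J).

End Coherence.

(* The usual topology and norm of the field R[i] over itself; the library has
   them only on the alias R[i]^o. *)
HB.instance Definition _ (R : rcfType) := NormedModule.copy R[i] R[i]^o.

Lemma near_cst_differentiable (K : numFieldType) (V W : normedModType K)
    (f : V -> W) (x : V) (c : W) :
  (\forall y \near x, f y = c) -> differentiable f x.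
Proof.
move=> fc; have fx : f x = c := nbhs_singleton fc.
have fc0 : \forall h \near (0 : V), f (h + x) = c.
  by move: fc; rewrite (near_shift 0) subr0.
have df : f \o shift x = cst (f x) + \0 +o_ (0 : V) id.
  apply/eqaddoP => e e0; near=> h.
  rewrite !fctE /= (near fc0 h) // fx addr0 subrr normr0.
  by rewrite mulr_ge0 // ltW.
have c0 : continuous (\0 : V -> W) by move=> y; exact: cvg_cst.
have d0 := diff_unique c0 df.
by apply/diff_locallyP; rewrite d0.
Unshelve. all: by end_near. Qed.

Section BallAlgebra.
Variables (R : realType) (n : nat).
Local Notation C := R[i].

(* Points of C^n are row vectors. The library norm on 'rV_n is the sup norm,
   so the Euclidean ball is spelled out; the sum is a nonnegative real element
   of C and <= is the order of R there. The topology is the usual one. *)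
Definition closed_unit_ball : set 'rV[C]_n :=
  [set z | \sum_j `|z 0 j| ^+ 2 <= 1].

(* Since the scalar field of 'rV[C]_n and C is C, the differential is C-linear:
   [differentiable] is complex differentiability. *)
Definition holomorphic_on (D : set 'rV[C]_n) (f : 'rV[C]_n -> C) : Prop :=
  forall z, D z -> differentiable f z.

(* Functions on the ball as a subspace; [valL_ 0 f] extends f by 0 outside the
   ball, which does not affect differentiability at interior points. *)
Definition in_ball_algebra : {pred closed_unit_ball -> C} := fun f =>
  `[< continuous f /\ holomorphic_on closed_unit_ball^° (valL_ 0 f) >].

Lemma valL_ball (f : closed_unit_ball -> C) z (Bz : z \in closed_unit_ball) :
  valL_ 0 f z = f (SigSub Bz).
Proof. by rewrite -[in RHS](valLK 0 f). Qed.

Lemma valL_ballB (f g : closed_unit_ball -> C) :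
  valL_ 0 (f - g) = valL_ 0 f - valL_ 0 g.
Proof.
apply/funext => z; rewrite !fctE /valL_ /=.
by case: ('oinv_set_val z) => [x|] //=; rewrite subr0.
Qed.

Lemma valL_ballM (f g : closed_unit_ball -> C) :
  valL_ 0 (f * g) = valL_ 0 f * valL_ 0 g.
Proof.
apply/funext => z; rewrite !fctE /valL_ /=.
by case: ('oinv_set_val z) => [x|] //=; rewrite mulr0.
Qed.

Lemma differentiable_valL_ball1 z :
  closed_unit_ball^° z ->
  differentiable (valL_ 0 (1 : closed_unit_ball -> C)) z.
Proof.
move=> Bz; apply: (@near_cst_differentiable C 'rV[C]_n C _ z 1).
by apply: filterS Bz => w /mem_set Bw; rewrite valL_ball.
Qed.

Fact in_ball_algebra_subring : GRing.subring_closed in_ball_algebra.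
Proof.
split=> [|f g /asboolP[cf hf] /asboolP[cg hg]|f g /asboolP[cf hf] /asboolP[cg hg]].
- by apply/asboolP; split=> z; [exact: cst_continuous|exact: differentiable_valL_ball1].
- apply/asboolP; split=> z; first exact: cvgB (cf z) (cg z).
  by move=> Bz; rewrite valL_ballB; apply: differentiableB; [exact: hf|exact: hg].
- apply/asboolP; split=> z; first exact: cvgM (cf z) (cg z).
  by move=> Bz; rewrite valL_ballM; apply: differentiableM; [exact: hf|exact: hg].
Qed.

HB.instance Definition _ :=
  GRing.isSubringClosed.Build _ in_ball_algebra in_ball_algebra_subring.

Record ball_algebra := BallAlgebra {
  ball_fun :> closed_unit_ball -> C;
  ball_funP : ball_fun \in in_ball_algebra }.

HB.instance Definition _ := [isSub for ball_fun].
HB.instance Definition _ := [Choice of ball_algebra by <:].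
HB.instance Definition _ :=
  GRing.SubChoice_isSubComPzRing.Build _ in_ball_algebra ball_algebra
    in_ball_algebra_subring.

End BallAlgebra.

(* Main.v *)
Require Import Defs.
From HB Require Import structures.
From mathcomp Require Import all_boot all_order all_algebra.
From mathcomp Require Import all_classical all_reals all_analysis.
From mathcomp Require Import complex ring lra.

(* Let p = 1 - z_1, let S = exp (-1 / p) be the atomic inner function in z_1,
   and let q = p S. At the vertex e_1 = (1, 0, ..., 0), the only zero of p on
   the ball, S is discontinuous but bounded, so S g is in the algebra whenever
   g (e_1) = 0. Suppose that (p) and (q) meet in a finitely generated ideal
   (h_1, ..., h_k), and write h_i = p u_i = q v_i. Off e_1 we have u_i = S v_i,
   and S takes two different values on sequences tending to e_1, so
   v_i (e_1) = u_i (e_1) = 0. Hence S u_i is in the algebra and q u_i = p (S u_i)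
   is in the intersection, which gives S u_i = sum_j c_ij u_j off e_1. Since
   p q is in the intersection too, the u_i have no common zero off e_1, and
   therefore S (z) is an eigenvalue of the matrix C (z) = (c_ij (z)). Now S
   takes the value exp (-a), for every real a >= 1, at points arbitrarily
   close to e_1, so all the exp (-a) are eigenvalues of C (e_1): a
   contradiction. *)

Set Implicit Arguments.
Unset Strict Implicit.
Unset Printing Implicit Defensive.

Import Order.TTheory GRing.Theory Num.Theory.
Import numFieldNormedType.Exports.

Local Open Scope classical_set_scope.
Local Open Scope ring_scope.
Local Open Scope complex_scope.

(** * The exponential function of a complex variable *)

Section ComplexExponential.
Variable R : realType.
Local Notation Re := (@complex.Re R).
Local Notation Im := (@complex.Im R).
Implicit Types z w : R[i].

Definition cexp z : R[i] :=
  expR (Re z) * cos (Im z) +i* (expR (Re z) * sin (Im z)).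

Lemma cexpD z w : cexp (z + w) = cexp z * cexp w.
Proof.
case: z w => [a b] [c d]; rewrite /cexp /= expRD cosD sinD.
by apply/eqP; rewrite eq_complex /=; apply/andP; split; apply/eqP; ring.
Qed.

Lemma normr_cexp z : `|cexp z| = (expR (Re z))%:C.
Proof.
rewrite normc_def /= !exprMn -mulrDr cos2Dsin2 mulr1 sqrtr_sqr.
by rewrite ger0_norm ?expR_ge0.
Qed.

Lemma cexp_neq0 z : cexp z != 0.
Proof. by rewrite -normr_eq0 normr_cexp eq_complex /= expR_eq0. Qed.

Lemma is_derive_approx0 (f : R -> R) (d : R) : is_derive (0 : R) (1 : R) f d ->
  forall e : R, 0 < e ->
    \forall t \near (0 : R), `|f t - f 0 - d * t| <= e * `|t|.
Proof.
move=> [/derivable_nbhs + <-] e e0 => /eqaddoP /(_ e e0).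
apply: filterS => t; rewrite !fctE /= addr0 scaler1 opprD addrA.
by rewrite [t *: _]mulrC.
Qed.

Lemma ler_norm_sqrt_sqrD (x y : R) : `|x| <= Num.sqrt (x ^+ 2 + y ^+ 2).
Proof. by rewrite -sqrtr_sqr ler_wsqrtr// lerDl sqr_ge0. Qed.

Lemma near_Re_Im (P : R -> Prop) : (\forall t \near (0 : R), P t) ->
  \forall z \near (0 : R[i]), P (Re z) /\ P (Im z).
Proof.
move=> /nbhs_ballP[d /= d0 dP].
apply/nbhs_ballP; exists d%:C => /=; first by rewrite ltcR.
move=> z; rewrite /ball /= sub0r normrN => zd.
have H : Num.sqrt (Re z ^+ 2 + Im z ^+ 2) < d by rewrite -ltcR -normc_def.
split; apply: dP; rewrite /ball /= sub0r normrN; apply: le_lt_trans H.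
  exact: ler_norm_sqrt_sqrD.
by rewrite addrC ler_norm_sqrt_sqrD.
Qed.

Lemma cexp_approx0 (e : R) : 0 < e ->
  \forall z \near (0 : R[i]), `|cexp z - 1 - z| <= e%:C * `|z|.
Proof.
(* The real and imaginary parts of the error each collect three terms e / 6, hence at most e / 2
   times the modulus of [z]. *)
move=> e0; have k0 : 0 < e / 6 by rewrite divr_gt0.
have exp1 := is_derive_approx0 (is_derive_expR 0) k0.
have cos1 := is_derive_approx0 (is_derive_cos 0) k0.
have sin1 := is_derive_approx0 (is_derive_sin 0) k0.
have exp2 : \forall t \near (0 : R), `|expR 0 - expR t| <= e / 6.
  by have /cvgrPdist_le/(_ _ k0) := @continuous_expR R 0.
have exp3 : \forall t \near (0 : R), `|expR 0 - expR t| <= 1.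
  by have /cvgrPdist_le/(_ _ ltr01) := @continuous_expR R 0.
have /near_Re_Im : \forall t \near (0 : R),
    [/\ `|expR t - expR 0 - expR 0 * t| <= e / 6 * `|t|,
        `|cos t - cos 0 - - sin 0 * t| <= e / 6 * `|t|,
        `|sin t - sin 0 - cos 0 * t| <= e / 6 * `|t|,
        `|expR 0 - expR t| <= e / 6 & `|expR 0 - expR t| <= 1].
  by near=> t; split; near: t.
apply: filterS => -[x y] /= [[ex _ _ ex2 ex3] [_ cy sy _ _]].
move: ex cy sy ex2 ex3; rewrite !expR0 cos0 sin0 oppr0 !mul0r !mul1r !subr0.
rewrite addr0 !normc_def -(rmorphM (real_complex R)) lecR /=.
set r := Num.sqrt (x ^+ 2 + y ^+ 2) => ex cy sy ex2 ex3.
have xr : `|x| <= r := ler_norm_sqrt_sqrD _ _.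
have yr : `|y| <= r by rewrite /r addrC ler_norm_sqrt_sqrD.
have e20 : `|expR x| <= 2.
  by rewrite ger0_norm ?expR_ge0//; move: ex3; rewrite ler_distlC; lra.
have A1 : `|expR x * cos y - 1 - x| <= e / 2 * r.
  have -> : expR x * cos y - 1 - x = (expR x - 1 - x) + expR x * (cos y - 1).
    by ring.
  apply: le_trans (ler_normD _ _) _; rewrite normrM.
  have : `|expR x| * `|cos y - 1| <= 2 * (e / 6 * `|y|) by apply: ler_pM.
  have : e / 6 * `|x| <= e / 6 * r by rewrite ler_pM2l.
  have : e / 6 * `|y| <= e / 6 * r by rewrite ler_pM2l.
  lra.
have A2 : `|expR x * sin y - y| <= e / 2 * r.
  have -> : expR x * sin y - y = expR x * (sin y - y) - (1 - expR x) * y.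
    by ring.
  apply: le_trans (ler_normB _ _) _; rewrite !normrM.
  have : `|expR x| * `|sin y - y| <= 2 * (e / 6 * `|y|) by apply: ler_pM.
  have : `|1 - expR x| * `|y| <= e / 6 * `|y| by apply: ler_pM.
  have : e / 6 * `|y| <= e / 6 * r by rewrite ler_pM2l.
  lra.
have r0 : 0 <= r := sqrtr_ge0 _.
simpc.
rewrite -[leRHS]ger0_norm ?mulr_ge0 ?(ltW e0)// -sqrtr_sqr ler_wsqrtr//.
have /= : e * r = e / 2 * r + e / 2 * r by field.
move: A1 A2; set p := _ - x; set q := _ - y; move: (e / 2 * r) => E A1 A2 ->.
rewrite -[p ^+ 2]real_normK ?num_real// -[q ^+ 2]real_normK ?num_real//.
by have := normr_ge0 p; have := normr_ge0 q; nra.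
Unshelve. all: by end_near. Qed.

(** The addition formula reduces the difference quotient at [z] to the estimate at 0, taken with [e]
    divided by the modulus of [cexp z]. *)
Lemma differentiable_cexp z : differentiable cexp z.
Proof.
apply/derivable1_diffP/cvg_ex; exists (cexp z).
apply/cvgrPdist_le => e e0.
have c0 : 0 < `|cexp z| by rewrite normr_gt0 cexp_neq0.
have e1 : (Re (e / `|cexp z|))%:C = e / `|cexp z|.
  by apply: RRe_real; rewrite gtr0_real// divr_gt0.
have e2 : 0 < Re (e / `|cexp z|) by rewrite -ltcR e1 divr_gt0.
have := cexp_approx0 e2; rewrite e1 => ee.
rewrite /dnbhs near_withinE; apply: filterS ee => h + h0 /=.
rewrite [h *: 1]mulr1 cexpD => hh.
change (`|cexp z - h^-1 * (cexp h * cexp z - cexp z)| <= e).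
have -> : cexp z - h^-1 * (cexp h * cexp z - cexp z) =
    h^-1 * (cexp z * - (cexp h - 1 - h)) by field.
rewrite !normrM normfV normrN mulrC ler_pdivrMr ?normr_gt0//.
by rewrite mulrC -ler_pdivlMr// mulrAC.
Qed.

End ComplexExponential.

(** The difference of the two functions is locally constant. This serves to replace an extension by
    zero with a formula near an interior point. *)
Lemma near_eq_differentiable (K : numFieldType) (V W : normedModType K)
    (f g : V -> W) x :
  (\forall y \near x, f y = g y) -> differentiable f x -> differentiable g x.
Proof.
move=> fg df; have -> : g = f + (g - f) by rewrite addrC subrK.
apply: differentiableD => //; apply: (@near_cst_differentiable _ _ _ _ _ 0).
by apply: filterS fg => y fgy; rewrite !fctE fgy subrr.
Qed.

(** * Elements of the ball algebra *)

Section Ball.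
Variables (R : realType) (n : nat).
Local Notation C := R[i].
Local Notation Re := (@complex.Re R).
Local Notation Im := (@complex.Im R).
Local Notation B := (@closed_unit_ball R n.+1).
Local Notation A := (ball_algebra R n.+1).

Lemma ball_algebraP (f g : A) : (forall z, f z = g z) -> f = g.
Proof. by move=> fg; apply/val_inj/funext. Qed.

Lemma ball_algebraM (f g : A) z : (f * g) z = f z * g z.
Proof. by []. Qed.

Lemma ball_algebraB (f g : A) z : (f - g) z = f z - g z.
Proof. by []. Qed.

(** Made a ring morphism below, so that evaluation commutes with sums and determinants over the
    algebra. *)
Definition ball_eval (z : B) (f : A) : C := f z.

Fact ball_eval_zmod z : zmod_morphism (ball_eval z).
Proof. by []. Qed.

Fact ball_eval_monoid z : monoid_morphism (ball_eval z).
Proof. by []. Qed.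

HB.instance Definition _ z :=
  GRing.isZmodMorphism.Build _ _ (ball_eval z) (ball_eval_zmod z).
HB.instance Definition _ z :=
  GRing.isMonoidMorphism.Build _ _ (ball_eval z) (ball_eval_monoid z).

Lemma continuous_ball (f : A) : continuous f.
Proof. by have /asboolP[] := ball_funP f. Qed.

Lemma differentiable_ball (f : A) z : B^° z -> differentiable (valL_ 0 f) z.
Proof. by have /asboolP[_] := ball_funP f; exact. Qed.

Lemma differentiable_continuous_ball (F : 'rV[C]_n.+1 -> C) (z : B) :
  differentiable F (val z) -> {for z, continuous (fun x : B => F (val x))}.
Proof.
move=> dF; apply: (@continuous_comp _ _ _ (val : B -> _) F).
  exact: initial_continuous.
exact: differentiable_continuous.
Qed.

Lemma ball_restriction (F : 'rV[C]_n.+1 -> C) :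
  (forall z, differentiable F z) ->
  exists f : A, forall z : B, f z = F (val z).
Proof.
move=> dF.
have Ff : (fun z : B => F (val z)) \in @in_ball_algebra R n.+1.
  apply/asboolP; split.
    by move=> z; exact: differentiable_continuous_ball.
  move=> z Bz; apply: near_eq_differentiable (dF z).
  by apply: filterS Bz => w /mem_set Bw; rewrite valL_ball.
by exists (BallAlgebra Ff).
Qed.

Lemma norm_coord_ball (z : 'rV[C]_n.+1) : B z -> `|z 0 0| <= 1.
Proof.
rewrite /closed_unit_ball /= (bigD1 0)//= => z1.
rewrite -(@expr_le1 _ 2)//; apply: le_trans z1.
by rewrite lerDl sumr_ge0// => j _; rewrite exprn_ge0.
Qed.

(** * The function p = 1 - z_1 and the atomic inner function S *)

Definition vertex_gap (z : 'rV[C]_n.+1) : C := 1 - z 0 0.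

Lemma Re_vertex_gap_ge0 z : B z -> 0 <= Re (vertex_gap z).
Proof.
move=> /norm_coord_ball z1; rewrite /vertex_gap raddfB/= subr_ge0.
apply: le_trans (ler_norm _) _.
by have := le_trans (normc_ge_Re (z 0 0)) z1; rewrite lecR.
Qed.

Lemma differentiable_vertex_gap z : differentiable vertex_gap z.
Proof.
apply: differentiableB; first exact: differentiable_cst.
exact: differentiable_coord.
Qed.

Lemma nbhs_delta0 (z : 'rV[C]_n.+1) U : nbhs z U ->
  exists2 e : C, 0 < e & forall t, `|t| < e -> U (z + t *: delta_mx 0 0).
Proof.
move=> /nbhs_ballP[e /= e0 eU]; exists e => // t te.
apply: eU; split => // i j; rewrite !mxE /ball /= opprD addNKr normrN.
by apply: le_lt_trans te; rewrite normrM ler_piMr// normr_nat lern1 leq_b1.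
Qed.

(** If z_1 = 1, any positive increase of the first coordinate leaves the ball. *)
Lemma interior_vertex_gap_neq0 z : B^° z -> vertex_gap z != 0.
Proof.
move=> Bz; apply/negP => /eqP /subr0_eq z1.
have [e e0 eB] := nbhs_delta0 Bz.
have /norm_coord_ball : B (z + (e / 2) *: delta_mx 0 0).
  by apply: eB; rewrite gtr0_norm ?divr_gt0// gtr_pMr// invf_lt1 ?ltr1n.
rewrite !mxE -z1 !eqxx /= mulr1 ger0_norm ?addr_ge0 ?divr_ge0 ?(ltW e0)//.
by rewrite gerDl lt_geF ?divr_gt0.
Qed.

(* At the vertex, where 0^-1 = 0, this takes the junk value 1. *)
Definition atomic_inner (z : 'rV[C]_n.+1) : C := cexp (- (vertex_gap z)^-1).

(** Inversion preserves nonnegativity of the real part (also at 0, whose inverse is 0), so the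
    exponent has real part at most 0. *)
Lemma norm_atomic_inner_le1 z : B z -> `|atomic_inner z| <= 1.
Proof.
move=> Bz; rewrite normr_cexp lecR -expR0 ler_expR raddfN /= oppr_le0.
have := Re_vertex_gap_ge0 Bz; case: (vertex_gap z) => a b /= a0.
by rewrite divr_ge0// addr_ge0 ?sqr_ge0.
Qed.

Lemma differentiable_atomic_inner z :
  vertex_gap z != 0 -> differentiable atomic_inner z.
Proof.
move=> p0; apply: differentiable_comp; last exact: differentiable_cexp.
have dV : differentiable (fun y => (vertex_gap y)^-1) z.
  exact: differentiableV (differentiable_vertex_gap z) p0.
exact: differentiableN dV.
Qed.

(** Continuity is in question only at the vertex, where the bound 1 on [atomic_inner] makes the
    product tend to 0 with [g]. The zero of [g] also absorbs the default value there. *)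
Lemma atomic_inner_mul (g : A) :
  (forall z : B, vertex_gap (val z) = 0 -> g z = 0) ->
  exists h : A, forall z : B, h z = atomic_inner (val z) * g z.
Proof.
move=> g0.
have hA : (fun z : B => atomic_inner (val z) * g z) \in @in_ball_algebra R n.+1.
  apply/asboolP; split => z.
    have [p0|p0] := eqVneq (vertex_gap (val z)) 0; last first.
      have Sz := differentiable_continuous_ball
        (differentiable_atomic_inner p0).
      exact: cvgM Sz (@continuous_ball g z).
    rewrite /continuous_at (g0 z p0) mulr0.
    have := @continuous_ball g z; rewrite /continuous_at (g0 z p0) => gz.
    apply/(@cvgr0Pnorm_le _ _ _ _ (nbhs_filter z)) => e e0.
    have := @cvgr0_norm_le _ _ _ _ (nbhs_filter z) _ gz e e0.
    apply: (@filterS _ _ (nbhs_filter z)) => w; apply: le_trans.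
    by rewrite normrM ler_piMl// norm_atomic_inner_le1//; exact: set_valP.
  move=> Bz; apply: (@near_eq_differentiable _ _ _ (atomic_inner * valL_ 0 g)).
    by apply: filterS Bz => w /mem_set Bw; rewrite !fctE !valL_ball.
  apply: differentiableM; last exact: differentiable_ball.
  exact/differentiable_atomic_inner/interior_vertex_gap_neq0.
by exists (BallAlgebra hA).
Qed.

(** * The vertex, and the level sets of S accumulating there *)

Lemma ball_vertex : B (delta_mx 0 0).
Proof.
rewrite /closed_unit_ball /= (bigD1 0)//= !mxE !eqxx /= normr1 expr1n.
by rewrite big1 ?addr0// => j /negPf j0; rewrite !mxE j0 andbF normr0 expr0n.
Qed.

Definition vertex : B := SigSub (mem_set ball_vertex).

(** A first coordinate 1 exhausts the bound on the sum of squares, which forces the other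
    coordinates to be 0. *)
Lemma vertex_gap_eq0 (z : B) : vertex_gap (val z) = 0 -> z = vertex.
Proof.
move=> /subr0_eq z1; apply/val_inj/rowP => j /=.
have : \sum_j `|val z 0 j| ^+ 2 <= 1 := set_valP z.
rewrite !mxE (bigD1 0)//= -z1 normr1 expr1n gerDl => s0.
have [->|j0] := eqVneq j 0; first by rewrite -z1.
have s00 : \sum_(i < n.+1 | i != 0) `|val z 0 i| ^+ 2 = 0.
  by apply/eqP; rewrite eq_le s0 sumr_ge0// => i _; rewrite exprn_ge0.
have := psumr_eq0P (fun i _ => exprn_ge0 _ (normr_ge0 _)) s00 j0.
by move=> /eqP; rewrite expf_eq0/= normr_eq0 => /eqP.
Qed.

(* Take 1 / w = a + 2 pi m i with m large. *)
Lemma cexp_invN_level (a : R) (e : C) : 1 <= a -> 0 < e ->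
  exists2 w : C, 0 < `|w| < e &
    `|1 - w| <= 1 /\ cexp (- w^-1) = (expR (- a))%:C.
Proof.
move=> a1 e0; have a0 : 0 < a by lra.
have re : (Re e)%:C = e by apply: RRe_real; rewrite gtr0_real.
have re0 : 0 < Re e by rewrite -ltcR re.
pose m := (Num.truncn (Re e)^-1).+1.
have m_gt : (Re e)^-1 < m%:R by rewrite truncnS_gt.
pose s : C := a +i* (pi *+ 2 *+ m).
have s0 : s != 0 by rewrite eq_complex /= negb_and gt_eqF.
have nsR : `|Im s|%:C <= `|s|.
  by rewrite normc_def lecR addrC ler_norm_sqrt_sqrD.
exists s^-1; rewrite ?normfV ?invr_gt0 ?normr_gt0 ?s0/=.
  rewrite -[e]invrK ltf_pV2 ?posrE ?normr_gt0 ?invr_gt0//.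
  apply: lt_le_trans nsR; rewrite -re -fmorphV ltcR.
  apply: lt_le_trans m_gt _; rewrite /= ger0_norm; last first.
    by do 2 apply: mulrn_wge0; exact: pi_ge0.
  rewrite -[leLHS]mulr1 mulr_natl lerMn2r; apply/orP; right.
  by have := pi_ge2 R; rewrite mulr2n; lra.
split.
  (* Keeping 1 - w in the unit disc amounts to |s - 1| <= |s|, that is Re s >= 1 / 2, which [1 <= a]
     ensures. *)
  have -> : 1 - s^-1 = (s - 1) / s by field.
  rewrite normrM normfV ler_pdivrMr ?normr_gt0// mul1r !normc_def lecR.
  rewrite ler_wsqrtr//= subr0.
  by rewrite lerD2r ler_sqr ?nnegrE; lra.
rewrite invrK /cexp /= sinN cosN.
have [-> ->] : cos (pi *+ 2 *+ m) = 1 :> R /\ sin (pi *+ 2 *+ m) = 0 :> R.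
  elim: m {m_gt s s0 nsR} => [|k [ck sk]]; first by rewrite mulr0n cos0 sin0.
  rewrite mulrSr (cosD (_ *+ k)) (sinD (_ *+ k)) cos2pi sin2pi ck sk.
  by split; ring.
by rewrite oppr0 mulr0 mulr1.
Qed.

(** The points where [atomic_inner] equals exp (-a) accumulate at the vertex, and [f] is
    continuous. *)
Lemma vanishing_at_vertex (a : R) (f : A) : 1 <= a ->
    (forall z : B, vertex_gap (val z) != 0 ->
      atomic_inner (val z) = (expR (- a))%:C -> f z = 0) ->
  f vertex = 0.
Proof.
move=> a1 fa; apply/eqP/negPn/negP => fv0.
have /cvgrPdist_lt/(_ `|f vertex|) := @continuous_ball f vertex.
rewrite normr_gt0 => /(_ fv0) [U [[V oV <-] /= Vv] VU].
have /nbhs_delta0[e e0 eV] : nbhs (delta_mx 0 0 : 'rV[C]_n.+1) V.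
  by apply: open_nbhs_nbhs; split.
have [w /andP[w0 we] [w1 ew]] := cexp_invN_level a1 e0.
have wV := eV (- w); rewrite normrN in wV.
pose z : 'rV[C]_n.+1 := delta_mx 0 0 + - w *: delta_mx 0 0.
have Bz : B z.
  rewrite /closed_unit_ball /= (bigD1 0)//= !mxE !eqxx /= mulr1 big1.
    by rewrite addr0 expr_le1.
  by move=> j /negPf j0; rewrite !mxE j0 andbF mulr0 addr0 normr0 expr0n.
pose z' : B := SigSub (mem_set Bz).
have pz : vertex_gap (val z') = w.
  by rewrite /vertex_gap /= !mxE !eqxx mulr1 opprD opprK addrA subrr add0r.
have : f z' = 0 by apply: fa; rewrite /atomic_inner pz// -normr_gt0.
have := VU z' (wV we) => /= + fz; by rewrite fz subr0 ltxx.
Qed.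

End Ball.

(** * Eigenvalues of a matrix, and generators of ideals *)

Lemma finitely_many_eigenvalues (F : fieldType) k (M : 'M[F]_k) (l : nat -> F) :
  injective l -> ~ (forall m, \det ((l m)%:M - M) = 0).
Proof.
move=> injl detM.
have rootl m : root (char_poly M) (l m).
  rewrite -eigenvalue_root_char.
  have /det0P[v v0] : \det ((l m)%:M - M) == 0 by rewrite detM.
  rewrite mulmxBr mul_mx_scalar => /subr0_eq vM.
  by apply/eigenvalueP; exists v.
(* The characteristic polynomial has degree [k], so k + 1 distinct roots are too many. *)
have := @max_poly_roots _ (char_poly M) [seq l m | m <- iota 0 k.+1].
rewrite monic_neq0 ?char_poly_monic// size_char_poly size_map size_iota ltnn.
rewrite map_inj_uniq// iota_uniq all_map.
rewrite (eq_all (a2 := predT)); last by move=> m; rewrite /= rootl.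
by rewrite all_predT => /(_ isT isT isT).
Qed.

Lemma principal_idealP (A : comPzRingType) (p x : A) :
  ideal_of (fun _ : 'I_1 => p) x <-> exists c, x = c * p.
Proof.
split=> [[c ->]|[c ->]]; first by exists (c ord0); rewrite big_ord1.
by exists (fun=> c); rewrite big_ord1.
Qed.

Lemma ideal_of_gen (A : comPzRingType) k (a : 'I_k -> A) i : ideal_of a (a i).
Proof.
exists (fun j => (j == i)%:R); rewrite (bigD1 i)//= eqxx mul1r.
rewrite big1 ?addr0// => j; by move=> /negPf ->; rewrite mul0r.
Qed.

(** * Failure of coherence *)

Lemma noncoherent_ball_algebra (R : realType) (n : nat) :
  ~ coherent (ball_algebra R n.+1).
Proof.
set A := ball_algebra R n.+1; set B := @closed_unit_ball R n.+1 => coh.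
have [P PE] := ball_restriction (@differentiable_vertex_gap R n).
have [Q QE] : exists Q : A, forall z : B, Q z = atomic_inner (val z) * P z.
  by apply: atomic_inner_mul => z; rewrite PE.
have cst_ex (c : R[i]) : exists f : A, forall z : B, f z = c.
  by apply: (@ball_restriction _ _ (cst c)) => z; exact: differentiable_cst.
pose I := ideal_of (fun _ : 'I_1 => P); pose J := ideal_of (fun _ : 'I_1 => Q).
have [k [h IJ]] : fg_ideal (I `&` J) by apply: coh; exists 1%N; eexists.
have inIJ x : ideal_of h x <-> (exists c, x = c * P) /\ (exists c, x = c * Q).
  by rewrite -IJ -!principal_idealP.
have uv_ex i : exists uv : A * A, h i = uv.1 * P /\ h i = uv.2 * Q.
  by have /inIJ[[u uE] [v vE]] := ideal_of_gen h i; exists (u, v).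
have [uv uvE] := choice uv_ex.
pose u i := (uv i).1; pose v i := (uv i).2.
have hu i : h i = u i * P := (uvE i).1.
have hv i : h i = v i * Q := (uvE i).2.
have uvz i (z : B) : vertex_gap (val z) != 0 ->
    u i z = atomic_inner (val z) * v i z.
  move=> p0; have := congr1 (fun f : A => f z) (hu i).
  rewrite hv !ball_algebraM QE PE mulrA => /(mulIf p0) <-.
  by rewrite mulrC.
(* On the level set S = exp (-a) the relation u_i = S v_i has a constant coefficient, so it passes
   to the limit at the vertex. *)
have uv_vertex (a : R) i : 1 <= a ->
    u i (vertex R n) = (expR (- a))%:C * v i (vertex R n).
  move=> a1; have [c cE] := cst_ex (expR (- a))%:C.
  apply/eqP; rewrite -subr_eq0 -(cE (vertex R n)) -ball_algebraM -ball_algebraB.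
  apply/eqP; apply: (vanishing_at_vertex a1) => z p0 za.
  by rewrite ball_algebraB ball_algebraM cE uvz// za subrr.
(* The levels a = 1 and a = 2 give the same u_i from two different multiples of v_i. *)
have v0 i : v i (vertex R n) = 0.
  have e12 : (expR (- 1))%:C - (expR (- 2))%:C != 0 :> R[i].
    by rewrite subr_eq0 eq_complex /= eqxx andbT gt_eqF// ltr_expR ltrN2 ltr1n.
  by apply: (mulfI e12); rewrite mulr0 mulrBl -!uv_vertex ?ler1n ?lexx ?subrr.
have u0 i : u i (vertex R n) = 0 by rewrite (uv_vertex 1)// v0 mulr0.
(* Since u_i vanishes at the vertex, x = S u_i is in the algebra, and [u i * Q] equals [x * P]. *)
have x_ex i : exists c : 'I_k -> A, u i * Q = \sum_j c j * h j.
  have [x xE] : exists x : A, forall z : B, x z = atomic_inner (val z) * u i z.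
    by apply: atomic_inner_mul => z /vertex_gap_eq0 ->.
  apply/inIJ; split; last by exists (u i).
  exists x; apply: ball_algebraP => z.
  by rewrite !ball_algebraM QE xE mulrCA mulrA.
have [c cE] := choice x_ex.
(* At a common zero of the u_i the product [P * Q] would vanish, which happens only at the
   vertex. *)
have [d dE] : ideal_of h (P * Q).
  by apply/inIJ; split; [exists Q; rewrite mulrC|exists P].
pose M := \matrix_(i, j) c i j.
have sumh (b : 'I_k -> A) (z : B) :
    (\sum_j b j * h j) z = (\sum_j b j z * u j z) * P z.
  rewrite -/(ball_eval z _) raddf_sum mulr_suml; apply: eq_bigr => j _.
  by rewrite hu mulrA.
have eigen (z : B) : vertex_gap (val z) != 0 ->
    \det ((atomic_inner (val z))%:M - map_mx (ball_eval z) M) = 0.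
  (* The kernel vector (u_1, ..., u_k) acts as a column, whereas [det0P] asks for a row; hence the
     transpose. *)
  move=> p0; apply/eqP; rewrite -det_tr; apply/det0P.
  exists (\row_j u j z).
    apply/eqP => uz; have := congr1 (fun f : A => f z) dE.
    rewrite sumh big1; last first.
      by move=> j _; have /rowP/(_ j) := uz; rewrite !mxE => ->; rewrite mulr0.
    move/eqP; rewrite mul0r ball_algebraM QE PE !mulf_eq0 !(negPf p0) orbF.
    by rewrite (negPf (cexp_neq0 _)).
  rewrite linearB /= tr_scalar_mx mulmxBr mul_mx_scalar; apply/rowP => i.
  rewrite !mxE; apply/eqP; rewrite subr_eq0; apply/eqP.
  have := congr1 (fun f : A => f z) (cE i).
  rewrite sumh ball_algebraM QE mulrA PE => /(mulIf p0) uE.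
  by rewrite mulrC [LHS]uE; apply: eq_bigr => j _; rewrite !mxE mulrC.
(* The shift to m + 1 keeps every level within the range a >= 1. *)
have inj_exp : injective (fun m : nat => (expR (- m.+1%:R))%:C : R[i]).
  by move=> m m' /complexI/expR_inj/oppr_inj/eqP; rewrite eqr_nat => /eqP[].
apply: (finitely_many_eigenvalues
  (M := map_mx (ball_eval (vertex R n)) M) inj_exp).
(* With the level as a constant function, the determinant is itself an element of the algebra, so
   its zeros on the level set carry over to the vertex. *)
move=> m; have [e eE] := cst_ex (expR (- m.+1%:R))%:C.
have detE (z : B) : (\det (e%:M - M)) z =
    \det ((expR (- m.+1%:R))%:C%:M - map_mx (ball_eval z) M).
  rewrite -/(ball_eval z _) -det_map_mx map_mxB map_scalar_mx /=.
  by rewrite /ball_eval eE.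
rewrite -detE; apply: (@vanishing_at_vertex _ _ m.+1%:R).
  by rewrite ler1n.
by move=> z p0 za; rewrite detE -za eigen.
Qed.

Theorem theorem4p1 (R : realType) (n : nat) (n_ge1 : (1 <= n)%N) :
  ~ coherent (ball_algebra R n).
Proof. by case: n n_ge1 => // n _; exact: noncoherent_ball_algebra. Qed.
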